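(* Let $D$ be the center of an $A_5^8(1)$-polytope in $4_{21}$. Then $D+3K_{S_8}$ is a skew $3$-line, $D+3K_{S_8}=l_a+l_b+l_c$ with $l_a,l_b,l_c\in L_8$ pairwise disjoint. Furthermore, each $A_5^8(1)$-polytope in $4_{21}$ with center $D$ contains exactly three cornered $A_3^8(1)$-polytopes (as four-element subsets), and these are contained in the vertex figures of $l_a$, $l_b$ and $l_c$ respectively.
   Context: $S_8$ is a del Pezzo surface obtained by blowing up $\mathbb{P}^2$ at $8$ points (with $-K_{S_8}$ ample). $\mathrm{Pic}\,S_8=\mathbb{Z}h\oplus\mathbb{Z}e_1\oplus\dots\oplus\mathbb{Z}e_8$ with intersection form $h^2=1$, $h\cdot e_i=0$, $e_i\cdot e_j=-\delta_{ij}$, and $K_{S_8}=-3h+\sum_{i=1}^8 e_i$. A line is a class $l\in\mathrm{Pic}\,S_8$ with $l^2=l\cdot K_{S_8}=-1$; $L_8$ is the set of lines, which is the vertex set of the Gosset polytope $4_{21}$ (the convex hull of $L_8$). A skew $a$-line is a class $l_1+\dots+l_a$ with $l_1,\dots,l_a\in L_8$ distinct and pairwise disjoint ($l_i\cdot l_j=0$ for $i\ne j$); the set $\{l_1,\dots,l_a\}$ is uniquely determined by the class. An $A_n^8(1)$-polytope in $4_{21}$ is a set of $n+1$ distinct lines in $L_8$ with pairwise intersection number $1$; its center is the sum of these lines. The vertex figure of $l\in L_8$ is $\{l'\in L_8: l'\cdot l=0\}$. An $A_n^8(1)$-polytope is cornered if there is a line $l\in L_8$ whose vertex figure contains all its lines.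 *)

(* Defs.v *)
From HB Require Import structures.
From mathcomp Require Import all_boot all_order all_algebra finmap.
Set Implicit Arguments.
Unset Strict Implicit.
Unset Printing Implicit Defensive.
Import Order.TTheory GRing.Theory Num.Theory.
Local Open Scope ring_scope.

(* The Picard lattice of a degree 1 del Pezzo surface (blow-up of P^2 at eight
   points), in the basis h, e_1, ..., e_8: coordinate 0 is the coefficient of
   h and coordinate [lift ord0 i] that of e_(i+1).  The lattice, the form and
   the canonical class do not depend on the choice of the points. *)
Notation Pic := 'rV[int]_9.

Definition h : Pic := delta_mx 0 0.
Definition e (i : 'I_8) : Pic := delta_mx 0 (lift ord0 i).

Definition dot (x y : Pic) : int :=
  x 0 0 * y 0 0 - \sum_(i < 8) x 0 (lift ord0 i) * y 0 (lift ord0 i).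

Lemma dot_hh : dot h h = 1.
Proof.
rewrite /dot !mxE big1 ?subr0 // => i _.
by rewrite !mxE.
Qed.

Lemma dot_he i : dot h (e i) = 0.
Proof.
rewrite /dot big1 => [|j _]; first by rewrite !mxE.
by rewrite !mxE /= mul0r.
Qed.

Lemma dot_ee i j : dot (e i) (e j) = - (i == j)%:R.
Proof.
rewrite /dot (bigD1 i) //= big1 => [|k neq_ki].
  by rewrite !mxE !eqxx /= !(inj_eq lift_inj) !mul0r sub0r addr0 mul1r.
by rewrite !mxE /= !(inj_eq lift_inj) (negPf neq_ki) mul0r.
Qed.

Definition K : Pic := - (h *+ 3) + \sum_(i < 8) e i.

Definition L8 : pred Pic := [pred l | (dot l l == -1) && (dot l K == -1)].

Definition sum_of (A : {fset Pic}) : Pic := \sum_(l <- A) l.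

Definition skew_line (a : nat) (D : Pic) : Prop :=
  exists A : {fset Pic},
    [/\ #|` A| = a, {subset A <= L8},
        {in A &, forall l l', l != l' -> dot l l' = 0} & D = sum_of A].

(* A_n^8(1)-polytopes, given by their vertex sets. *)
Definition A1_polytope (n : nat) (A : {fset Pic}) : Prop :=
  [/\ #|` A| = n.+1, {subset A <= L8}
    & {in A &, forall l l', l != l' -> dot l l' = 1}].

Definition vertex_figure (l : Pic) : pred Pic :=
  [pred l' | (l' \in L8) && (dot l' l == 0)].

Definition cornered (A : {fset Pic}) : Prop :=
  exists2 l, l \in L8 & {subset A <= vertex_figure l}.

(* Main.v *)
Require Import Defs.
From HB Require Import structures.
From mathcomp Require Import all_boot all_order all_algebra finmap.
From mathcomp Require Import mxabelem.
From mathcomp Require Import zify ring.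
Set Implicit Arguments.
Unset Strict Implicit.
Unset Printing Implicit Defensive.
Import Order.TTheory GRing.Theory Num.Theory.
Local Open Scope ring_scope.

(** Adding [K] to a line gives a root of the lattice orthogonal to [K], which
    is negative definite and even (it is E8 up to sign); since [dot K K = 1],
    lines meeting once become orthogonal roots, and disjoint lines become roots
    [s], [s'] with [dot s s' = -1].  So six lines [A] with center [D], any two
    of them meeting once, amount to six mutually orthogonal roots [r_i], and the
    question is which half sums of the [r_i] lie in the lattice.

    Existence ([two_even_subsums], [half_subset_sum]).  Modulo 2 the six roots
    span a totally isotropic subspace of F_2^9 with its standard form, hence
    have rank at most 4, so at least two distinct nonempty subfamilies have a
    sum divisible by 2.  Evenness of the lattice forces each of these to have
    four elements, and half of its sum is then a root, that is, a line [l]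
    whose product with [E = D + 3K] is -1.  Two such lines [l1], [l2] are
    disjoint by definiteness, and [E - l1 - l2] is again a line, disjoint from
    both ([skew_completion]).

    Cornered tetrads.  A tetrad [T] of [A] in the vertex figure of [l] consists
    of four orthogonal roots whose products with [l + K] are all extremal for
    the Bessel inequality, so [2(l + K)] is the sum of its roots
    ([vertex_figure_sum]); consequently [dot l E = -1].  Since distinct lines
    have nonnegative product, [E = la + lb + lc] leaves only [la], [lb], [lc]
    for [l] ([skew_lines_unique]).  Conversely [dot l E = -1] says that the
    Bessel coefficients of [l + K] along the six roots add up to 4, while their
    squares add up to at most 4: they are four ones and two zeros, so that [l]
    is disjoint from exactly four lines of [A] ([card_vertex_figure_part]). *)

(** * Bilinearity of the intersection form *)

Lemma dotC x y : dot x y = dot y x.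
Proof.
by rewrite /dot mulrC; congr (_ - _); apply: eq_bigr => i _; rewrite mulrC.
Qed.

Fact dot_linear x : linear_for *%R (dot x).
Proof.
move=> a u v; rewrite /dot !mxE mulrBr mulr_sumr.
under eq_bigr do rewrite !mxE mulrDr.
rewrite big_split /= mulrDr opprD mulrCA.
under [in RHS]eq_bigr do rewrite mulrCA.
ring.
Qed.

HB.instance Definition _ x :=
  GRing.isLinear.Build int Pic int *%R (dot x) (dot_linear x).

Lemma dotDr x y z : dot x (y + z) = dot x y + dot x z.
Proof. exact: raddfD. Qed.
Lemma dotDl x y z : dot (x + y) z = dot x z + dot y z.
Proof. by rewrite !(dotC _ z) dotDr. Qed.
Lemma dotNr x y : dot x (- y) = - dot x y.
Proof. exact: raddfN. Qed.
Lemma dotNl x y : dot (- x) y = - dot x y.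
Proof. by rewrite !(dotC _ y) dotNr. Qed.
Lemma dotMnr x y n : dot x (y *+ n) = dot x y *+ n.
Proof. exact: raddfMn. Qed.
Lemma dotMnl x y n : dot (x *+ n) y = dot x y *+ n.
Proof. by rewrite !(dotC _ y) dotMnr. Qed.
Lemma dotZr a x y : dot x (a *: y) = a * dot x y.
Proof. exact: linearZ. Qed.
Lemma dotZl a x y : dot (a *: x) y = a * dot x y.
Proof. by rewrite !(dotC _ y) dotZr. Qed.
Lemma dot_sumr x (I : Type) (s : seq I) (P : pred I) (F : I -> Pic) :
  dot x (\sum_(i <- s | P i) F i) = \sum_(i <- s | P i) dot x (F i).
Proof. exact: raddf_sum. Qed.
Lemma dot_suml x (I : Type) (s : seq I) (P : pred I) (F : I -> Pic) :
  dot (\sum_(i <- s | P i) F i) x = \sum_(i <- s | P i) dot (F i) x.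
Proof. by rewrite dotC dot_sumr; apply: eq_bigr => i _; rewrite dotC. Qed.

Definition dot_linl := (dotDl, dotNl, dotMnl).
Definition dot_linE := (dotDl, dotDr, dotNl, dotNr, dotMnl, dotMnr).

(** Stated for an arbitrary [k], so that rewriting with bilinearity never
    meets the class [K], itself a sum that would be expanded. *)
Lemma dot_translate k x y :
  dot (x + k) (y + k) = dot x y + dot x k + dot y k + dot k k.
Proof. by rewrite !dot_linE (dotC k y); ring. Qed.

(** * The even negative definite lattice orthogonal to the canonical class *)

Lemma K_coord0 : K 0 0 = -3.
Proof. by rewrite /K !mxE summxE big1 // => i _; rewrite mxE. Qed.

Lemma K_coord_lift i : K 0 (lift ord0 i) = 1.
Proof.
rewrite /K !mxE summxE (bigD1 i) // big1 => [|j ji]; first by rewrite mxE !eqxx.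
by rewrite !mxE /= (inj_eq lift_inj) eq_sym (negPf ji).
Qed.

Lemma dot_K x : dot x K = - (3 * x 0 0) - \sum_(i < 8) x 0 (lift ord0 i).
Proof.
rewrite /dot K_coord0; under eq_bigr do rewrite K_coord_lift mulr1.
by congr (_ - _); ring.
Qed.

Lemma dot_KK : dot K K = 1.
Proof.
rewrite dot_K K_coord0; under eq_bigr do rewrite K_coord_lift.
by rewrite sumr_const card_ord.
Qed.

(** Orthogonality to [K] says that the last eight coordinates add up to minus
    three times the first, [x 0 0]; completing the squares in them with the
    shift [3/8 * x 0 0] uses this and leaves a negative definite diagonal form.
    The factor 64 clears denominators. *)
Lemma K_perp_norm x : dot x K = 0 ->
  64 * dot x x = - (8 * x 0 0 ^+ 2)
    - \sum_(i < 8) (8 * x 0 (lift ord0 i) + 3 * x 0 0) ^+ 2.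
Proof.
have sq (y z : int) :
    (8 * y + 3 * z) ^+ 2 = 64 * (y * y) + 48 * z * y + 9 * z ^+ 2 by ring.
rewrite dot_K /dot => x_K; under [in RHS]eq_bigr do rewrite sq.
rewrite !big_split /= -!mulr_sumr sumr_const card_ord.
have -> : \sum_(i < 8) x 0 (lift ord0 i) = - (3 * x 0 0) by lia.
by rewrite expr2; ring.
Qed.

Lemma K_perp_norm_le0 x : dot x K = 0 -> dot x x <= 0.
Proof.
move=> /K_perp_norm xx; suff : 64 * dot x x <= 0 by lia.
rewrite xx -opprD oppr_le0 addr_ge0 ?sumr_ge0 // => [|i _]; last exact: sqr_ge0.
by rewrite pmulr_rge0 ?sqr_ge0.
Qed.

Lemma K_perp_norm_eq0 x : dot x K = 0 -> dot x x = 0 -> x = 0.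
Proof.
move=> /K_perp_norm + xx; rewrite xx mulr0 => /esym/eqP.
rewrite -opprD oppr_eq0 paddr_eq0; first last.
- by rewrite sumr_ge0 // => i _; apply: sqr_ge0.
- by rewrite pmulr_rge0 ?sqr_ge0.
case/andP; rewrite mulf_eq0 sqrf_eq0 /= => /eqP x0.
rewrite psumr_eq0 => [|i _]; last exact: sqr_ge0.
move/allP=> xi; apply/rowP=> j; rewrite mxE.
case: (unliftP ord0 j) => [i ->|-> //].
move: (xi i (mem_index_enum i)); rewrite x0 mulr0 addr0 sqrf_eq0 mulf_eq0 /=.
by move/eqP.
Qed.

(** [K] is a characteristic vector of the form, because [z * (z + 1)] is even
    in each coordinate; in particular the lattice orthogonal to [K] is even. *)
Lemma dot_parity x : exists m, dot x x + dot x K = m * 2.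
Proof.
have par (z : int) : exists m, z * (z + 1) = m * 2.
  have [k [-> | ->]] : exists k, z = k * 2 \/ z = k * 2 + 1.
    by exists (z %/ 2)%Z; lia.
  - by exists (k * (k * 2 + 1)); ring.
  - by exists ((k * 2 + 1) * (k + 1)); ring.
have [m Em] : exists m,
    \sum_(i < 8) x 0 (lift ord0 i) * (x 0 (lift ord0 i) + 1) = m * 2.
  elim/big_ind: _ => [|_ _ [a ->] [b ->]|i _]; last exact: par.
    by exists 0; rewrite mul0r.
  by exists (a + b); rewrite mulrDl.
have [k Ek] := par (x 0 0); exists (k - 2 * x 0 0 - m).
rewrite dot_K /dot !mulrBl -Ek -Em.
under [in RHS]eq_bigr do rewrite mulrDr mulr1.
by rewrite big_split /=; ring.
Qed.

(** * Linear relations modulo 2 *)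

Lemma dvdz2_F2 (z : int) : (2 %| z)%Z = (z%:~R == 0 :> 'F_2).
Proof. by rewrite -(@dvdz_pcharf 'F_2 2) // pchar_Fp. Qed.

Lemma F2_indicator (a : 'F_2) : a = (a != 0)%:R.
Proof. by apply/val_inj; case: a => [[|[|]]]. Qed.

Lemma half_int_vector (n : nat) (v : 'rV[int]_n) :
  (forall j, (v 0 j)%:~R = 0 :> 'F_2) -> exists s, v = s *+ 2.
Proof.
move=> v_even; exists (\row_j divz (v 0 j) 2); apply/rowP => j.
rewrite mulmxnE mxE -[RHS]mulr_natr divzK // dvdz2_F2.
exact/eqP.
Qed.

(** Reduced modulo 2, the form is the standard dot product of F_2^9, signs
    being irrelevant.  Vectors with even products (self-products included)
    therefore form a matrix [M] with [M *m M^T = 0], whose rank is at most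
    9/2; with six or more rows its left kernel has at least four elements, and
    a kernel vector is the indicator of a subfamily with even sum. *)
Lemma two_even_subsums (I : finType) (r : I -> Pic) :
    (6 <= #|I|)%N -> (forall i j, (2 %| dot (r i) (r j))%Z) ->
  exists X Y : {set I},
    [/\ [/\ X != set0, Y != set0 & X != Y],
        exists s, \sum_(i in X) r i = s *+ 2
      & exists s, \sum_(i in Y) r i = s *+ 2].
Proof.
move=> I_ge6 r_even.
pose M : 'M['F_2]_(#|I|, 9) := \matrix_(i, j) (r (enum_val i) 0 j)%:~R.
have MMt : M *m M^T = 0.
  apply/matrixP => i k; rewrite !mxE.
  under eq_bigr do rewrite !mxE -intrM.
  rewrite -(rmorph_sum (intmul 1 : int -> 'F_2)); apply/eqP; rewrite -dvdz2_F2.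
  set a := r _; set b := r _.
  (* Changing the signs of eight terms costs an even correction. *)
  have -> : \sum_j a 0 j * b 0 j = 2 * (a 0 0 * b 0 0) - dot a b.
    by rewrite big_ord_recl /dot; ring.
  by rewrite rpredB ?dvdz_mulr //; apply: r_even.
have rkM : (\rank M <= 4)%N.
  by have := mulmx0_rank_max MMt; rewrite mxrank_tr; lia.
pose C := rowg (kermx M).
have C_gt1 : (1 < #|C :\ 0%R|)%N.
  have C0 : 0 \in C by rewrite mem_rowg sub0mx.
  have : (2 ^ 2 <= #|C|)%N.
    rewrite card_rowg mxrank_ker card_Fp // leq_exp2l //.
    exact: leq_sub I_ge6 rkM.
  by rewrite (cardsD1 0 C) C0 add1n ltnS; apply: ltnW.
have [c [d [cC dC cd]]] :
    exists c d, [/\ c \in C :\ 0, d \in C :\ 0 & c != d].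
  exact/card_gt1P.
pose supp (x : 'rV['F_2]_#|I|) := [set i | x 0 (enum_rank i) != 0].
have supp_half x : x \in C -> exists s, \sum_(i in supp x) r i = s *+ 2.
  rewrite mem_rowg => /sub_kermxP xM; apply: half_int_vector => j.
  have := congr1 (fun y : 'rV_9 => y 0 j) xM; rewrite !mxE => <-.
  rewrite summxE rmorph_sum big_mkcond.
  rewrite (reindex _ (onW_bij _ (@enum_val_bij I))) /=.
  apply: eq_bigr => k _; rewrite inE enum_valK mxE (F2_indicator (x 0 k)).
  by case: (x 0 k == 0); rewrite /= ?mul0r ?mul1r.
have supp_inj : injective supp.
  move=> x y /setP xy; apply/rowP => k; have := xy (enum_val k).
  rewrite !inE enum_valK => xyk.
  by rewrite (F2_indicator (x 0 k)) xyk -F2_indicator.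
have supp0 : supp 0 = set0 by apply/setP => i; rewrite !inE mxE.
move: cC dC; rewrite !in_setD1 => /andP[c0 cC] /andP[d0 dC].
exists (supp c), (supp d); split; [split| exact: supp_half | exact: supp_half].
- by rewrite -supp0 (inj_eq supp_inj).
- by rewrite -supp0 (inj_eq supp_inj).
- by rewrite (inj_eq supp_inj).
Qed.

(** * Families of orthogonal roots *)

Definition orthogonal_roots (I : finType) (r : I -> Pic) : Prop :=
  (forall i, dot (r i) K = 0) /\
  (forall i j, dot (r i) (r j) = if i == j then -2 else 0).

Lemma dot_combination (I : finType) (r : I -> Pic) (x : I -> int) j :
  orthogonal_roots r -> dot (\sum_i x i *: r i) (r j) = -2 * x j.
Proof.
move=> [_ rr]; rewrite dot_suml (bigD1 j) //= big1 => [|i ij].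
  by rewrite dotZl rr eqxx addr0 mulrC.
by rewrite dotZl rr (negPf ij) mulr0.
Qed.

(** [u] is twice the component of [s] orthogonal to the family, its norm being
    computed by Pythagoras.  Doubling keeps it in the lattice, the
    coefficients of the projection of [s] being [x i / 2]. *)
Lemma bessel_defect (I : finType) (r : I -> Pic) s :
  orthogonal_roots r ->
  let x i := - dot s (r i) in
  let u := s *+ 2 - \sum_i x i *: r i in
  dot u u = 4 * dot s s + 2 * \sum_i x i ^+ 2.
Proof.
move=> rr x u; rewrite /u; set v := \sum_i _.
have sv : dot s v = - \sum_i x i ^+ 2.
  by rewrite dot_sumr -sumrN; apply: eq_bigr => i _; rewrite dotZr /x; ring.
have vv : dot v v = -2 * \sum_i x i ^+ 2.
  rewrite {2}/v dot_sumr mulr_sumr; apply: eq_bigr => i _.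
  by rewrite dotZr dot_combination //; ring.
by rewrite !dot_linE (dotC v s) vv sv; ring.
Qed.

Lemma bessel_defect_perp (I : finType) (r : I -> Pic) s (x : I -> int) :
  orthogonal_roots r -> dot s K = 0 ->
  dot (s *+ 2 - \sum_i x i *: r i) K = 0.
Proof.
move=> [rK _] sK; rewrite !dot_linl sK dot_suml big1 ?subr0 // => i _.
by rewrite dotZl rK mulr0.
Qed.

Lemma dot_subset_sum (I : finType) (r : I -> Pic) (X : {set I}) j :
  orthogonal_roots r -> dot (\sum_(i in X) r i) (r j) = -2 * (j \in X)%:R.
Proof.
move=> rr; rewrite -(dot_combination (fun i => (i \in X)%:R) j rr).
rewrite big_mkcond; congr (dot _ _); apply: eq_bigr => i _.
by case: (i \in X); rewrite ?scale1r ?scale0r.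
Qed.

Lemma dot_subset_sums (I : finType) (r : I -> Pic) (X Y : {set I}) :
  orthogonal_roots r ->
  dot (\sum_(i in X) r i) (\sum_(i in Y) r i) = -2 * #|X :&: Y|%:R.
Proof.
move=> rr; rewrite dot_sumr; under eq_bigr do rewrite dot_subset_sum //.
rewrite -mulr_sumr -natr_sum -sum1_card [in RHS]big_mkcond [in LHS]big_mkcond.
congr (_ * _%:R); apply: eq_bigr => i _.
by rewrite inE andbC; case: (i \in Y); case: (i \in X).
Qed.

(** Comparing norms, [4 * dot s s = -2 * #|X|]; as [dot s s] is even, [#|X|]
    is a multiple of 4, hence equal to 4 when there are fewer than eight roots
    in all. *)
Lemma half_subset_sum (I : finType) (r : I -> Pic) (X : {set I}) s :
    orthogonal_roots r -> (#|I| < 8)%N ->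
    X != set0 -> \sum_(i in X) r i = s *+ 2 ->
  [/\ dot s K = 0, dot s s = -2 & dot s (\sum_i r i) = -4].
Proof.
move=> rr I_lt8 X_n0 Xs.
have sK : dot s K = 0.
  suff : dot (s *+ 2) K = 0 by rewrite dotMnl; lia.
  by rewrite -Xs dot_suml big1 // => i _; exact: rr.1.
have ss : 4 * dot s s = -2 * #|X|%:R.
  by rewrite -(setIid X) -(dot_subset_sums _ _ rr) Xs !dot_linE; ring.
have sw : 2 * dot s (\sum_i r i) = -2 * #|X|%:R.
  rewrite -(setIT X) -(dot_subset_sums _ _ rr) Xs dotMnl mulr_natl.
  by congr (dot _ _ *+ _); apply: eq_bigl => i; rewrite inE.
have [m] := dot_parity s; rewrite sK addr0 => ssm.
have X_gt0 : (0 < #|X|)%N by rewrite card_gt0.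
have X_lt8 : (#|X| < 8)%N by apply: leq_ltn_trans I_lt8; exact: max_card.
by move: ss sw; rewrite natz; split=> //; lia.
Qed.

(** * Lines *)

Lemma line_norm l : l \in L8 -> dot l l = -1.
Proof. by case/andP => /eqP. Qed.

Lemma line_degree l : l \in L8 -> dot l K = -1.
Proof. by case/andP => _ /eqP. Qed.

Lemma mem_L8 l : dot l l = -1 -> dot l K = -1 -> l \in L8.
Proof. by move=> ll lK; rewrite inE ll lK !eqxx. Qed.

Lemma line_root_perp l : l \in L8 -> dot (l + K) K = 0.
Proof. by move=> lL; rewrite dotDl dot_KK line_degree. Qed.

Lemma dot_line_roots l l' : l \in L8 -> l' \in L8 ->
  dot (l + K) (l' + K) = dot l l' - 1.
Proof.
move=> lL lL'; rewrite dot_translate (line_degree lL) (line_degree lL') dot_KK.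
ring.
Qed.

Lemma line_of_root s : dot s K = 0 -> dot s s = -2 -> s - K \in L8.
Proof.
move=> sK ss; have lK : dot (s - K) K = -1 by rewrite dotDl dotNl sK dot_KK.
apply: mem_L8 => //; have := dot_translate K (s - K) (s - K).
by rewrite subrK ss lK dot_KK; lia.
Qed.

(** The difference of two distinct lines is a nonzero vector orthogonal to [K],
    so its norm [-2 - 2 * dot l l'] is negative. *)
Lemma line_dot_ge0 l l' : l \in L8 -> l' \in L8 -> l != l' -> 0 <= dot l l'.
Proof.
move=> lL lL' ll'.
have dK : dot (l - l') K = 0 by rewrite !dot_linl !line_degree.
have dd : dot (l - l') (l - l') = -2 - 2 * dot l l'.
  by rewrite !dot_linE (dotC l' l) !line_norm //; ring.
have d_n0 : dot (l - l') (l - l') <> 0.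
  by move/(K_perp_norm_eq0 dK)/eqP; rewrite subr_eq0 (negPf ll').
by have := K_perp_norm_le0 dK; lia.
Qed.

(** Let [l3 = E - l1 - l2]; then [l3 + K] is orthogonal to [K] and has norm
    [2 * dot l1 l2 - 2].  It is not zero, since otherwise [E = l1 + l2 - K] and
    [dot l1 E = dot l1 l2 = 1], not -1.  Definiteness and [line_dot_ge0] thus
    leave only [dot l1 l2 = 0]. *)
Lemma skew_completion E l1 l2 :
    dot E E = -3 -> dot E K = -3 -> l1 \in L8 -> l2 \in L8 -> l1 != l2 ->
    dot l1 E = -1 -> dot l2 E = -1 ->
  [/\ E - l1 - l2 \in L8, dot l1 l2 = 0,
      dot l1 (E - l1 - l2) = 0 & dot l2 (E - l1 - l2) = 0].
Proof.
move=> EE EK l1L l2L l12 l1E l2E.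
have [n1 n2] := (line_norm l1L, line_norm l2L).
have [k1 k2] := (line_degree l1L, line_degree l2L).
set l3 := E - l1 - l2.
have l3K : dot l3 K = -1 by rewrite !dot_linl EK k1 k2.
have l3l3 : dot l3 l3 = 2 * dot l1 l2 - 1.
  rewrite !dot_linE (dotC E l1) (dotC E l2) (dotC l2 l1) EE l1E l2E n1 n2; ring.
have sK : dot (l3 + K) K = 0 by rewrite dotDl l3K dot_KK.
have ss : dot (l3 + K) (l3 + K) = 2 * dot l1 l2 - 2.
  by rewrite dot_translate l3l3 l3K dot_KK; ring.
have s_n0 : dot (l3 + K) (l3 + K) <> 0.
  move=> ss0; have := congr1 (dot l1) (K_perp_norm_eq0 sK ss0).
  by move: ss; rewrite ss0 dotDr k1 linear0 !dot_linE l1E n1; lia.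
have l12_0 : dot l1 l2 = 0.
  by have := line_dot_ge0 l1L l2L l12; have := K_perp_norm_le0 sK; lia.
split => //.
- by apply: mem_L8; rewrite ?l3l3 ?l12_0.
- by rewrite !dot_linE l1E n1 l12_0.
- by rewrite !dot_linE l2E n2 (dotC l2 l1) l12_0.
Qed.

(** A line with product -1 with a sum of lines is one of them, all products of
    distinct lines being nonnegative. *)
Lemma skew_lines_unique la lb lc l :
    la \in L8 -> lb \in L8 -> lc \in L8 -> l \in L8 ->
    dot l (la + lb + lc) = -1 -> [\/ l = la, l = lb | l = lc].
Proof.
move=> aL bL cL lL; rewrite !dotDr.
have [-> _|la_n] := eqVneq l la; first by constructor 1.
have [-> _|lb_n] := eqVneq l lb; first by constructor 2.
have [-> _|lc_n] := eqVneq l lc; first by constructor 3.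
have := line_dot_ge0 lL aL la_n; have := line_dot_ge0 lL bL lb_n.
by have := line_dot_ge0 lL cL lc_n; lia.
Qed.

(** * Polytopes as families of orthogonal roots *)

Lemma polytope_roots n A : A1_polytope n A ->
  orthogonal_roots (fun t : A => val t + K).
Proof.
case=> _ AL A1; split=> [t|t t']; first exact/line_root_perp/AL/valP.
rewrite dot_line_roots; [|exact/AL/valP|exact/AL/valP].
have [<-|tt'] := eqVneq t t'; first by rewrite line_norm //; exact/AL/valP.
by rewrite A1 ?subrr //; exact: valP.
Qed.

Lemma polytope_card n (A : {fset Pic}) : A1_polytope n A -> #|{: A}| = n.+1.
Proof. by case=> cA _ _; rewrite -cardfE. Qed.

Lemma sum_line_roots n A : A1_polytope n A ->
  \sum_(t : A) (val t + K) = sum_of A + K *+ n.+1.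
Proof.
move=> An; rewrite big_split sumr_const (polytope_card An).
by rewrite /sum_of big_seq_fsetE.
Qed.

Lemma polytope_sum_norm n A : A1_polytope n A ->
  let w := sum_of A + K *+ n.+1 in
  dot w w = -2 * n.+1%:R /\ dot w K = 0.
Proof.
move=> An w; have rr := polytope_roots An.
have wE : w = \sum_(t in [set: A]) (val t + K).
  by rewrite /w -(sum_line_roots An); apply: eq_bigl => t; rewrite inE.
split.
  by rewrite wE (dot_subset_sums _ _ rr) setIid cardsT (polytope_card An).
by rewrite wE dot_suml big1 // => t _; apply: rr.1.
Qed.

(** * Lines of degree -1 on the reduced center *)

(** The class that is to be decomposed into three skew lines; for a line [l] of
    the decomposition, [dot l (reduced_center A) = -1], and this equation is the
    criterion used throughout to recognise the lines that corner four elements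
    of [A]. *)
Definition reduced_center (A : {fset Pic}) : Pic := sum_of A + K *+ 3.

Lemma reduced_centerE A : A1_polytope 5 A ->
  reduced_center A = \sum_(t : A) (val t + K) - K *+ 3.
Proof.
move=> A5; rewrite (sum_line_roots A5) /reduced_center -addrA; congr (_ + _).
by rewrite -mulrnBr.
Qed.

Lemma reduced_center_numbers A : A1_polytope 5 A ->
  dot (reduced_center A) (reduced_center A) = -3 /\
  dot (reduced_center A) K = -3.
Proof.
move=> A5; rewrite reduced_centerE // (sum_line_roots A5).
move: (sum_of A + K *+ 6) (polytope_sum_norm A5) => w [ww wK].
split; last by rewrite dotDl dotNl dotMnl wK dot_KK.
have sq k : dot (w - k *+ 3) (w - k *+ 3) = dot w w - 6 * dot w k + 9 * dot k k.
  by rewrite !dot_linE (dotC k w); ring.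
by rewrite sq ww wK dot_KK.
Qed.

Lemma dot_reduced_center A s : A1_polytope 5 A -> dot s K = 0 ->
  dot (s - K) (reduced_center A) = dot s (\sum_(t : A) (val t + K)) + 3.
Proof.
move=> A5 sK; rewrite reduced_centerE // (sum_line_roots A5).
move: (sum_of A + K *+ 6) (polytope_sum_norm A5) => w [_ wK].
have expand k :
    dot (s - k) (w - k *+ 3) = dot s w - 3 * dot s k - dot w k + 3 * dot k k.
  by rewrite !dot_linE (dotC k w); ring.
by rewrite expand sK wK dot_KK; ring.
Qed.

Lemma two_lines_of_degree_minus1 A : A1_polytope 5 A ->
  exists l1 l2, [/\ [/\ l1 \in L8, l2 \in L8 & l1 != l2],
    dot l1 (reduced_center A) = -1 & dot l2 (reduced_center A) = -1].
Proof.
move=> A5; have rr := polytope_roots A5; have cA := polytope_card A5.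
have [||X [Y [[X_n0 Y_n0 XY] [s Xs] [u Yu]]]] :=
    @two_even_subsums _ (fun t : A => val t + K).
- by rewrite cA.
- by move=> t t'; rewrite rr.2; case: (t == t').
have A_lt8 : (#|{: A}| < 8)%N by rewrite cA.
have [sK ss sw] := half_subset_sum rr A_lt8 X_n0 Xs.
have [uK uu uw] := half_subset_sum rr A_lt8 Y_n0 Yu.
exists (s - K), (u - K).
rewrite !dot_reduced_center // sw uw; split=> //.
split; [exact: line_of_root..|].
(* The half sum determines its subset through the products with the roots. *)
apply: contra_neq XY => /addIr su; apply/setP => t.
have := dot_subset_sum X t rr; rewrite Xs su -Yu (dot_subset_sum Y t rr).
by case: (t \in X); case: (t \in Y).
Qed.

(** The integers [x t = 1 - dot l t] add up to 4 and, by the Bessel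
    inequality, their squares add up to at most 4.  As [z <= z ^+ 2] for every
    integer, each of them is 0 or 1, and four of them are 1. *)
Lemma card_vertex_figure_part A l :
    A1_polytope 5 A -> l \in L8 -> dot l (reduced_center A) = -1 ->
  #|` [fset t in A | dot t l == 0]%fset| = 4.
Proof.
move=> A5 lL lE; have rr := polytope_roots A5; have lK := line_root_perp lL.
pose x (t : A) : int := - dot (l + K) (val t + K).
have xE t : x t = 1 - dot l (val t).
  by rewrite /x dot_line_roots ?opprB //; case: A5 => _ AL _; exact/AL/valP.
have sum_x : \sum_t x t = 4.
  have := dot_reduced_center A5 lK; rewrite addrK lE.
  by rewrite /x sumrN -dot_sumr; set a := dot _ _; lia.
have sum_x2 : \sum_t x t ^+ 2 <= 4.
  have := K_perp_norm_le0 (bessel_defect_perp x rr lK).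
  have := bessel_defect (l + K) rr.
  rewrite -/x => ->; rewrite dot_line_roots // (line_norm lL).
  by set S := \sum_i _; lia.
have x01 t : x t = (dot l (val t) == 0)%:R.
  have sq_ge (z : int) : 0 <= z ^+ 2 - z.
    rewrite (_ : _ - z = z * (z - 1)); last by ring.
    by have [z0|z0] := lerP z 0; [rewrite mulr_le0|rewrite mulr_ge0]; lia.
  have : \sum_t (x t ^+ 2 - x t) == 0.
    rewrite eq_le sumr_ge0 ?andbT => [|i _]; last exact: sq_ge.
    by rewrite sumrB sum_x subr_le0.
  rewrite psumr_eq0 => [|i _]; last exact: sq_ge.
  move/allP/(_ t (mem_index_enum t)) => /eqP; rewrite xE.
  rewrite (_ : _ - _ = (dot l (val t) - 1) * dot l (val t)); last by ring.
  move/eqP; rewrite mulf_eq0 subr_eq0; case: eqP => [-> //|_] /=.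
  by move/eqP => ->; rewrite subr0.
apply/eqP; rewrite -(eqr_nat int) -sum_x card_fset_sum1 -big_fset_condE.
rewrite natr_sum big_mkcond big_seq_fsetE; apply/eqP/eq_bigr => t _.
by rewrite x01 dotC; case: eqP.
Qed.

(** The Bessel coefficients of [l + K] along the four roots are all 1, so the
    inequality is an equality and [l + K] lies in the span of the roots. *)
Lemma vertex_figure_sum T l :
    A1_polytope 3 T -> l \in L8 -> {subset T <= vertex_figure l} ->
  (l + K) *+ 2 = \sum_(t : T) (val t + K).
Proof.
move=> T3 lL Tl; have rT := polytope_roots T3.
have lK := line_root_perp lL.
have x1 (t : T) : - dot (l + K) (val t + K) = 1.
  have /andP[tL /eqP tl] := Tl _ (valP t).
  by rewrite dot_line_roots // dotC tl.
apply/eqP; rewrite -subr_eq0; apply/eqP.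
have -> : \sum_(t : T) (val t + K) =
          \sum_(t : T) (- dot (l + K) (val t + K)) *: (val t + K).
  by apply: eq_bigr => t _; rewrite x1 scale1r.
apply: K_perp_norm_eq0; first exact: bessel_defect_perp.
rewrite bessel_defect // (eq_bigr (fun _ => 1)) => [|t _]; last by rewrite x1.
by rewrite sumr_const (polytope_card T3) dot_line_roots // (line_norm lL).
Qed.

Lemma vertex_figure_inj T l l' :
    A1_polytope 3 T -> l \in L8 -> l' \in L8 ->
    {subset T <= vertex_figure l} -> {subset T <= vertex_figure l'} ->
  l = l'.
Proof.
move=> T3 lL lL' Tl Tl'; apply: (@addIr _ K); apply/rowP => j.
have := vertex_figure_sum T3 lL Tl; rewrite -(vertex_figure_sum T3 lL' Tl').
by move/rowP/(_ j)/eqP; rewrite !mulmxnE eqr_pMn2r // => /eqP.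
Qed.

Lemma cornered_degree A T l :
    A1_polytope 5 A -> A1_polytope 3 T -> (T `<=` A)%fset -> l \in L8 ->
    {subset T <= vertex_figure l} ->
  dot l (reduced_center A) = -1.
Proof.
move=> A5 T3 /fsubsetP TA lL Tl.
have rA := polytope_roots A5; have lK := line_root_perp lL.
have half2 : 2 * dot (l + K) (\sum_(t : A) (val t + K)) = -8.
  rewrite mulr_natl -dotMnl (vertex_figure_sum T3 lL Tl) dot_suml.
  rewrite (eq_bigr (fun _ => -2)) => [|t _].
    by rewrite sumr_const (polytope_card T3).
  have tA := TA _ (valP t).
  have := dot_subset_sum setT [` tA]%fset rA; rewrite inE /= mulr1 dotC => <-.
  by congr (dot _ _); apply: eq_bigl => t'; rewrite inE.
by have := dot_reduced_center A5 lK; rewrite addrK => ->; lia.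
Qed.

(** * Decomposition of the reduced center and its cornered tetrads *)

Lemma reduced_center_skew A : A1_polytope 5 A -> skew_line 3 (reduced_center A).
Proof.
move=> A5; have [EE EK] := reduced_center_numbers A5.
have [l1 [l2 [[l1L l2L l12] l1E l2E]]] := two_lines_of_degree_minus1 A5.
have [l3L d12 d13 d23] := skew_completion EE EK l1L l2L l12 l1E l2E.
set l3 := _ - l1 - l2 in l3L d13 d23.
have neq l l' : l \in L8 -> dot l l' = 0 -> l != l'.
  by move=> /line_norm ll ll'; apply/eqP => e; move: ll; rewrite {2}e ll'.
have u : uniq [:: l1; l2; l3].
  by rewrite /= !inE negb_or !neq.
exists [fset l in [:: l1; l2; l3]]%fset; split.
- by rewrite card_fseq undup_id.
- by move=> l; rewrite !inE orbF => /or3P[] /eqP ->.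
- move=> l l'; rewrite !inE !orbF => /or3P[] /eqP -> /or3P[] /eqP -> //;
    rewrite ?eqxx // => _; by rewrite dotC.
- rewrite /sum_of big_imfset //.
  rewrite -[RHS]/(\sum_(l <- undup [:: l1; l2; l3]) l) (undup_id u).
  by rewrite !big_cons big_nil addr0 [l2 + _]addrC subrK addrC subrK.
Qed.

Theorem theorem24 (D : 'rV[int]_9)
    (hD : exists2 A : {fset 'rV[int]_9}, A1_polytope 5 A & D = sum_of A) :
  skew_line 3 (D + K *+ 3) /\
  forall la lb lc : 'rV[int]_9,
    la \in L8 -> lb \in L8 -> lc \in L8 ->
    dot la lb = 0 -> dot la lc = 0 -> dot lb lc = 0 ->
    D + K *+ 3 = la + lb + lc ->
    forall A : {fset 'rV[int]_9}, A1_polytope 5 A -> D = sum_of A ->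
    exists Ta Tb Tc : {fset 'rV[int]_9},
      [/\ [/\ Ta != Tb, Ta != Tc & Tb != Tc],
          forall T : {fset 'rV[int]_9},
            [/\ (T `<=` A)%fset, A1_polytope 3 T & cornered T]
            <-> [\/ T = Ta, T = Tb | T = Tc],
          {subset Ta <= vertex_figure la},
          {subset Tb <= vertex_figure lb}
        & {subset Tc <= vertex_figure lc}].
Proof.
split; first by case: hD => A A5 ->; exact: reduced_center_skew.
move=> la lb lc aL bL cL ab ac bc DE A A5 DA.
have AE : reduced_center A = la + lb + lc by rewrite /reduced_center -DA.
pose T (l : Pic) := [fset t in A | dot t l == 0]%fset.
have [_ AL A1] := A5.
have T_sub l : (T l `<=` A)%fset by exact: fset_sub.
have T_fig l : {subset T l <= vertex_figure l}.
  by move=> t; rewrite !inE /= => /andP[/AL tL ->]; rewrite andbT.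
have T_poly l : l \in L8 -> dot l (la + lb + lc) = -1 -> A1_polytope 3 (T l).
  move=> lL lE; split; first by apply: card_vertex_figure_part; rewrite ?AE.
    by move=> t /(fsubsetP (T_sub l)) /AL.
  by move=> t t' /(fsubsetP (T_sub l)) tA /(fsubsetP (T_sub l)); exact: A1.
have aE : dot la (la + lb + lc) = -1 by rewrite !dotDr ab ac line_norm.
have bE : dot lb (la + lb + lc) = -1.
  by rewrite !dotDr (dotC lb la) ab bc line_norm.
have cE : dot lc (la + lb + lc) = -1.
  by rewrite !dotDr !(dotC lc) ac bc (line_norm cL).
have T_inj l l' : l \in L8 -> l' \in L8 -> dot l (la + lb + lc) = -1 ->
    dot l l' = 0 -> T l != T l'.
  move=> lL lL' lE ll'; apply/eqP => TT.
  have ll := vertex_figure_inj (T_poly _ lL lE) lL lL' (T_fig l).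
  by move: (line_norm lL); rewrite {2}ll ?ll' // TT; exact: T_fig.
exists (T la), (T lb), (T lc); split; rewrite ?T_inj //.
move=> U; split=> [[UA U3 [l lL Ul]]|].
  have lE := cornered_degree A5 U3 UA lL Ul.
  have UT : U = T l.
    apply/eqP; rewrite eqEfcard (card_vertex_figure_part A5 lL lE).
    have [-> _ _] := U3; rewrite andbT; apply/fsubsetP => t tU.
    by rewrite !inE (fsubsetP UA _ tU); have /andP[] := Ul t tU.
  rewrite AE in lE.
  by rewrite UT; case: (skew_lines_unique aL bL cL lL lE) => ->;
    [constructor 1|constructor 2|constructor 3].
by case=> ->; split; do ?[exact: T_sub | exact: T_poly];
  [exists la | exists lb | exists lc].
Qed.
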